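(* Let $d\ge1$, $n\in\{1,2,\dots\}\cup\{\infty\}$, and let all the random variables $\xi(i,m)$, $1\le i\le n$ ($i$ finite), $m=1,\dots,d$, be centered and (totally, jointly) independent. Put $\nu_m(p)=\sup_i|\xi(i,m)|_p$ and assume that, for each $m$, $\nu_m\in G(\nu,r_m)$ for some $2<r_m<\infty$. Define for $p\ge2$ $$\zeta_1(p)=K_I(p)\,\nu_1(p),\qquad \zeta_{m+1}(p)=K_M(p)\,\zeta_m(p)\,\nu_{m+1}(p),\quad m=1,\dots,d-1,$$ that is, $\zeta_d(p)=K_I(p)\,K_M^{d-1}(p)\prod_{m=1}^d\nu_m(p)$. Then $$\sup_{b\in B(d,n)}\|Q(d,n,b)\|G(\zeta_d)\ \le\ \prod_{m=1}^d\|\vec\xi(m)\|G(\nu_m,r_m),$$ where, with $s=\min_m r_m$, $\|Q\|G(\zeta_d)=\sup_{p\in(2,s)}|Q|_p/\zeta_d(p)$ and $\|\vec\xi(m)\|G(\nu_m,r_m)=\sup_{p\in(2,r_m)}\sup_i|\xi(i,m)|_p/\nu_m(p)$.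
   Context: All random variables live on one probability space; $|\xi|_p=(\mathbf E|\xi|^p)^{1/p}$; $\vec\xi(m)=\{\xi(i,m)\}_i$. Suprema of nonnegative quantities over the empty set are $0$. Polynomial: $I(d,n)=\{(i_1,\dots,i_d):1\le i_1<i_2<\dots<i_d\le n\}$ (finite indices); for a real non-random array $b=(b(I))_{I\in I(d,n)}$, $$Q(d,n,b)=\sum_{I=(i_1,\dots,i_d)\in I(d,n)}b(I)\prod_{m=1}^d\xi(i_m,m).$$ For $n=\infty$, $Q(d,\infty,b)=\lim_{n\to\infty}Q(d,n,b)$, for those $b$ for which this limit exists with probability one. $B(d,n)=\{b:\sum_{I\in I(d,n)}b^2(I)=1\}$. Class $G(\nu,r)$ ($r>2$): functions $\nu$ that are continuous, positive and finite on $[1,r)$, with $\inf_{p\in(2,r)}\nu(p)>0$ and $\nu(p)=\infty$ for $p>r$. Constant $K_M(p)$, $p\ge2$: the smallest constant $K$ such that for every finite $n$, every sequence $\theta(1),\dots,\theta(n)$ of centered martingale differences relative to some filtration, and all real $b(1),\dots,b(n)$ with $\sum_i b^2(i)=1$, one has $\left|\sum_{i=1}^n b(i)\theta(i)\right|_p\le K\sup_i|\theta(i)|_p$. (It is known that $K_M(p)\le p\sqrt2$.) Constant $K_I(p)$, $p\ge2$: the smallest constant in the same inequality when $\theta(1),\dots,\theta(n)$ are restricted to be independent centered random variables. (It is known that $K_I(p)\le 0.87\,p/\log p$.) *)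

(* Defs.v *)
From HB Require Import structures.
From mathcomp Require Import all_boot all_order all_algebra.
From mathcomp Require Import finmap.
From mathcomp Require Import all_classical all_reals all_analysis.
Set Implicit Arguments.
Unset Strict Implicit.
Unset Printing Implicit Defensive.
Import Order.TTheory GRing.Theory Num.Theory.
Import numFieldNormedType.Exports.
Local Open Scope classical_set_scope.
Local Open Scope ring_scope.

(* Supremum of a set of nonnegative quantities; it is 0 on the empty set,
   where [ereal_sup] would give -oo. *)
Definition esup0 (R : realType) (A : set (\bar R)) : \bar R :=
  ereal_sup (0%E |` A).

(* The upper bound n in {1, 2, ...} \cup {oo} is an [option nat], with [None]
   for oo.  Indices start from 1, so that n = oo still means finite indices. *)
Definition indices (n : option nat) : set nat :=
  [set i | (1 <= i)%N /\ (if n is Some k then i <= k else true)%N].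

Definition incr_tuples (d : nat) (n : option nat) : set (d.-tuple nat) :=
  [set I : d.-tuple nat | sorted ltn I /\ forall m, indices n (tnth I m)].
Arguments incr_tuples : clear implicits.

(* B(d,n); only the values of b on I(d,n) matter. *)
Definition unit_arrays (R : realType) (d : nat) (n : option nat)
    : set (d.-tuple nat -> R) :=
  [set b : d.-tuple nat -> R | (\esum_(I in incr_tuples d n) (b I ^+ 2)%:E = 1)%E].
Arguments unit_arrays : clear implicits.

(* The class G(nu, r). *)
Definition classG (R : realType) (r : R) (nu : R -> \bar R) : Prop :=
  [/\ 2 < r,
      {within `[1, r[, continuous nu},
      (forall p, 1 <= p < r -> (0 < nu p < +oo)%E),
      (0 < ereal_inf [set nu p | p in [set p : R | (2 < p < r)%R]])%E &
      (forall p, r < p -> nu p = +oo%E)].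

(* sup over p in (2, s) of N p / psi p, where N p stands for a p-th moment
   norm. *)
Definition Gnorm (R : realType) (psi : R -> \bar R) (s : \bar R)
    (N : R -> \bar R) : \bar R :=
  esup0 [set (N p / psi p)%E | p in [set p : R | 2 < p /\ (p%:E < s)%E]].

Section probability.
Context d (T : measurableType d) (R : realType) (P : probability T R).

Definition rv_norm (p : R) (X : T -> R) : \bar R := 'N[P]_p%:E[EFin \o X]%E.

Definition centered (X : T -> R) : Prop :=
  P.-integrable setT (EFin \o X) /\ ('E_P[X] = 0)%E.

(* Mutual independence of the family (X i), i in D: the product rule over
   every finite subfamily. *)
Definition independent_RVs (I : choiceType) (D : set I)
    (X : I -> {RV P >-> R}) : Prop :=
  forall (J : {fset I}) (A : I -> set R),
    [set` J] `<=` D -> (forall i, i \in J -> measurable (A i)) ->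
    P (\bigcap_(i in [set` J]) (X i @^-1` A i)) =
    (\prod_(i <- J) P (X i @^-1` A i))%E.

Definition measurable_wrt (F : set (set T)) (X : T -> R) : Prop :=
  forall B : set R, measurable B -> F (X @^-1` B).

(* Y is a version of the conditional expectation E[X | F]. *)
Definition is_cond_exp (F : set (set T)) (X Y : T -> R) : Prop :=
  [/\ P.-integrable setT (EFin \o X), P.-integrable setT (EFin \o Y),
      measurable_wrt F Y &
      forall A, F A -> (\int[P]_(t in A) (Y t)%:E = \int[P]_(t in A) (X t)%:E)%E].

Definition filtration (F : nat -> set (set T)) : Prop :=
  [/\ forall i, sigma_algebra setT (F i),
      forall i, F i `<=` @measurable d T &
      forall i j, (i <= j)%N -> F i `<=` F j].

Definition martingale_differences (F : nat -> set (set T)) (n : nat)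
    (theta : nat -> {RV P >-> R}) : Prop :=
  filtration F /\
  forall i, indices (Some n) i ->
    measurable_wrt (F i) (theta i) /\
    is_cond_exp (F i.-1) (theta i) (cst 0).

(* The inequality |sum_i b(i) theta(i)|_p <= K sup_i |theta(i)|_p, for all real
   coefficients b with sum_i b(i)^2 = 1. *)
Definition l2_moment_bound (p K : R) (n : nat)
    (theta : nat -> {RV P >-> R}) : Prop :=
  forall b : nat -> R, \sum_(1 <= i < n.+1) b i ^+ 2 = 1 ->
    (rv_norm p (fun t => \sum_(1 <= i < n.+1) b i * theta i t)%R <=
     K%:E * esup0 [set rv_norm p (theta i) | i in indices (Some n)])%E.

(* The best constants, as extended reals: they are +oo if no finite constant
   is admissible.  The random variables theta live on the given probability
   space, like all the others; taking the best constant over all probability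
   spaces could only enlarge KM and KI, hence decrease the left-hand side of the
   inequality between G-norms. *)
Definition KM (p : R) : \bar R :=
  ereal_inf [set K%:E | K in [set K : R | 0 <= K /\
    forall (n : nat) (theta : nat -> {RV P >-> R}) (F : nat -> set (set T)),
      martingale_differences F n theta ->
      (forall i, indices (Some n) i -> centered (theta i)) ->
      l2_moment_bound p K n theta]].

Definition KI (p : R) : \bar R :=
  ereal_inf [set K%:E | K in [set K : R | 0 <= K /\
    forall (n : nat) (theta : nat -> {RV P >-> R}),
      independent_RVs (indices (Some n)) theta ->
      (forall i, indices (Some n) i -> centered (theta i)) ->
      l2_moment_bound p K n theta]].

Section polynomials.
Variables (D : nat) (xi : nat -> 'I_D -> {RV P >-> R}).

(* The polynomial Q(D, n, b) for finite n. *)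
Definition Qfin (b : D.-tuple nat -> R) (n : nat) (t : T) : R :=
  \sum_(I \in incr_tuples D (Some n)) (b I * \prod_(m < D) xi (tnth I m) m t).

(* X is Q(D, n, b).  For n = oo this determines X up to a null set, and no such
   X exists when the partial sums do not converge with probability one. *)
Definition is_Q (n : option nat) (b : D.-tuple nat -> R) (X : T -> R) : Prop :=
  match n with
  | Some k => X = Qfin b k
  | None => measurable_fun setT X /\
      {ae P, forall t, Qfin b k t @[k --> \oo] --> X t}
  end.

(* sup_i |xi(i,m)|_p *)
Definition sup_norm (n : option nat) (m : 'I_D) (p : R) : \bar R :=
  esup0 [set rv_norm p (xi i m) | i in indices n].

Definition zeta (n : option nat) (p : R) : \bar R :=
  (KI p * KM p ^+ D.-1 * \prod_(m < D) sup_norm n m p)%E.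

End polynomials.
End probability.

(* Main.v *)
(* Every factor on the right-hand side is at least 1, so it suffices to prove
   |Q(d,n,b)|_p <= zeta_d(p) for each p in (2, s).  For finite n, sort the terms
   of Q by their last index k: with b_k(I) = b(I, k),
     Q(d+1,n,b) = sum_k Q(d,k-1,b_k) xi(k,d+1).
   Put beta_k = |b_k|_2.  The variables
   theta_k = Q(d,k-1,b_k) xi(k,d+1) / beta_k are martingale differences for the
   filtration generated by the xi(i,m) with i <= k, because xi(k,d+1) is
   centered and independent of the past.  By independence and induction on d,
   |theta_k|_p <= zeta_d(p) nu_(d+1)(p), and the sum of the beta_k^2 is |b|_2^2,
   so the definition of K_M gives the bound in degree d+1; the base case is the
   definition of K_I.  The case n = oo follows by Fatou's lemma. *)
Require Import Defs.
From HB Require Import structures.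
From mathcomp Require Import all_boot all_order all_algebra.
From mathcomp Require Import finmap.
From mathcomp Require Import all_classical all_reals all_analysis measurable_realfun.
From mathcomp Require Import ring lra.
Set Implicit Arguments.
Unset Strict Implicit.
Unset Printing Implicit Defensive.
Import Order.TTheory GRing.Theory Num.Theory.
Import numFieldNormedType.Exports.
Local Open Scope classical_set_scope.
Local Open Scope ring_scope.

(** * Moment norms and products of independent variables *)

Section moment_norm.
Context (disp : measure_display) (T : measurableType disp) (R : realType)
  (P : probability T R).
Implicit Types (X Y : T -> R) (p : R).

Lemma rv_norm_ge0 p X : (0 <= rv_norm P p X)%E.
Proof. exact: Lnorm_ge0. Qed.

Lemma measurable_abs_powR p X : measurable_fun setT X ->
  measurable_fun setT (fun t => `|X t| `^ p).
Proof.
move=> mX; apply: (@measurableT_comp _ _ _ _ _ _ (@powR R ^~ p)) => //.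
exact: measurableT_comp.
Qed.

Lemma rv_normE p X :
  rv_norm P p X = ((\int[P]_t (`|X t| `^ p)%:E) `^ p^-1)%E.
Proof. by rewrite /rv_norm unlock. Qed.

Lemma rv_normZ p (c : R) X : 0 < p -> measurable_fun setT X ->
  rv_norm P p (fun t => c * X t) = (`|c|%:E * rv_norm P p X)%E.
Proof.
move=> p0 mX; rewrite !rv_normE.
under eq_integral do rewrite normrM powRM// EFinM.
rewrite ge0_integralZl//; last first.
  by apply/measurable_EFinP; exact: measurable_abs_powR.
rewrite poweRM ?lee_fin ?powR_ge0//; last first.
  by apply: integral_ge0 => t _; rewrite lee_fin powR_ge0.
by rewrite poweR_EFin -powRrM mulfV ?gt_eqF// powRr1.
Qed.

Lemma rv_norm_cst0 p : 0 < p -> rv_norm P p (cst 0) = 0%E.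
Proof. by move=> p0; rewrite /rv_norm (_ : _ \o _ = cst 0%E)// Lnorm0// gt_eqF// lte_fin. Qed.

(** On a probability space the bound [|x| <= 1 + |x|^p] dominates [X] by an integrable function. *)
Lemma integrable_rv_norm p X : 1 <= p -> measurable_fun setT X ->
  (rv_norm P p X < +oo)%E -> P.-integrable setT (EFin \o X).
Proof.
move=> p1 mX; rewrite rv_normE => Xoo.
have p0 : 0 < p by exact: lt_le_trans p1.
have {}Xoo : (\int[P]_t (`|X t| `^ p)%:E < +oo)%E.
  rewrite ltey; apply/eqP => Xy; move: Xoo.
  by rewrite Xy poweRyr ?ltxx// invr_neq0 ?gt_eqF.
apply: (@le_integrable _ _ _ _ _ _ _ (fun t => (1 + `|X t| `^ p)%:E)) => //.
- exact/measurable_EFinP.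
- move=> t _; rewrite lee_fin [leRHS]ger0_norm ?addr_ge0 ?powR_ge0//.
  have [Xt1|/ltW Xt1] := leP (`|X t|) 1; first by rewrite ler_wpDr ?powR_ge0.
  by rewrite ler_wpDl// -[leLHS]powRr1// ler_powR.
- have := @integrableD _ T R P setT measurableT (cst 1%:E) (fun t => (`|X t| `^ p)%:E).
  apply; first exact: finite_measure_integrable_cst.
  apply/integrableP; split.
    by apply/measurable_EFinP; exact: measurable_abs_powR.
  by under eq_integral do rewrite gee0_abs ?lee_fin ?powR_ge0//.
Qed.

Definition indep_pair X Y := forall A B : set R, measurable A -> measurable B ->
  P (X @^-1` A `&` Y @^-1` B) = (P (X @^-1` A) * P (Y @^-1` B))%E.

Section product.
Variables (X Y : {RV P >-> R}).
Hypothesis XY : indep_pair X Y.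

Let mXY : measurable_fun setT (fun t => (X t, Y t)).
Proof. exact: measurable_fun_pair. Qed.

Let XY_RV : {RV P >-> (R * R)%type} :=
  HB.pack (fun t => (X t, Y t)) (isMeasurableFun.Build _ _ _ _ _ mXY).

(** Independence gives equality on rectangles, and the product measure is determined by its values
    there. *)
Lemma distribution_indep_pair (A : set (R * R)) : measurable A ->
  (distribution P X \x distribution P Y)%E A = distribution P XY_RV A.
Proof.
by move=> mA; apply: product_measure_unique => //; exact: XY.
Qed.

Lemma ge0_integral_indep_pair (f g : R -> R) :
  measurable_fun setT f -> measurable_fun setT g ->
  (forall x, 0 <= f x) -> (forall x, 0 <= g x) ->
  (\int[P]_t (f (X t) * g (Y t))%:E =
   \int[P]_t (f (X t))%:E * \int[P]_t (g (Y t))%:E)%E.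
Proof.
move=> mf mg f0 g0.
have mfg : measurable_fun setT (fun z : R * R => (f z.1 * g z.2)%:E).
  apply/measurable_EFinP/measurable_funM; exact: measurableT_comp.
have h0 z : (0 <= (f z.1 * g z.2)%:E)%E by rewrite lee_fin mulr_ge0.
transitivity (\int[distribution P XY_RV]_z (f z.1 * g z.2)%:E)%E.
  by rewrite ge0_integral_distribution.
transitivity (\int[distribution P X \x distribution P Y]_z (f z.1 * g z.2)%:E)%E.
  by apply: eq_measure_integral => A mA _; exact/esym/distribution_indep_pair.
rewrite fubini_tonelli1//.
have mfE : measurable_fun setT (EFin \o f) by exact/measurable_EFinP.
have mgE : measurable_fun setT (EFin \o g) by exact/measurable_EFinP.
rewrite -(@ge0_integral_distribution _ _ _ _ _ P X (EFin \o f))//.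
rewrite -(@ge0_integral_distribution _ _ _ _ _ P Y (EFin \o g))//.
rewrite -ge0_integralZr//; last 2 first.
- by move=> x _; rewrite lee_fin.
- by apply: integral_ge0 => x _; rewrite lee_fin.
apply: eq_integral => x _; rewrite /fubini_F/=.
under eq_integral do rewrite EFinM.
by rewrite ge0_integralZl// ?lee_fin// => y _; rewrite lee_fin.
Qed.

(** The function [|x|^p |y|^p] has separated variables, so its integral against the product law
    factors, and so does the p-th root. *)
Lemma rv_norm_indep_pair p :
  rv_norm P p (fun t => X t * Y t) = (rv_norm P p X * rv_norm P p Y)%E.
Proof.
have mp : measurable_fun setT (fun x : R => `|x| `^ p).
  exact: (@measurableT_comp _ _ _ _ _ _ (@powR R ^~ p)).
rewrite !rv_normE -poweRM; last 2 first.
- by apply: integral_ge0 => t _; rewrite lee_fin powR_ge0.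
- by apply: integral_ge0 => t _; rewrite lee_fin powR_ge0.
rewrite -(ge0_integral_indep_pair mp mp)//.
by congr poweR; apply: eq_integral => t _; rewrite normrM powRM.
Qed.

Hypotheses (iX : P.-integrable setT (EFin \o X))
  (iY : P.-integrable setT (EFin \o Y)).

Lemma integrable_indep_pair : P.-integrable setT (EFin \o (X \* Y)).
Proof.
move: iX iY => /integrableP[_ iX'] /integrableP[_ iY'].
apply/integrableP; split; first exact/measurable_EFinP/measurable_funM.
under eq_integral do rewrite /= normrM.
have mn : measurable_fun setT (fun x : R => `|x|) by [].
rewrite (ge0_integral_indep_pair mn mn)//.
by apply: lte_mul_pinfty => //; [exact: integral_ge0|rewrite ge0_fin_numE// integral_ge0].
Qed.

(** By Fubini on the product law: the inner integral in y is [x * E Y = 0]. *)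
Lemma integral_indep_pair0 : ('E_P[Y] = 0)%E ->
  (\int[P]_t (X t * Y t)%:E = 0)%E.
Proof.
rewrite unlock => Y0.
have mfg : measurable_fun setT (fun z : R * R => (z.1 * z.2)%:E).
  exact/measurable_EFinP/measurable_funM.
have ifg : (distribution P XY_RV).-integrable setT (fun z : R * R => (z.1 * z.2)%:E).
  by apply: integrable_pushforward => //; exact: integrable_indep_pair.
transitivity (\int[distribution P XY_RV]_z (z.1 * z.2)%:E)%E.
  by rewrite integral_distribution//; exact: integrable_indep_pair.
transitivity (\int[distribution P X \x distribution P Y]_z (z.1 * z.2)%:E)%E.
  by apply: eq_measure_integral => A mA _; exact/esym/distribution_indep_pair.
rewrite -integral12_prod_meas1; last first.
  apply/integrableP; split => //; move/integrableP : ifg => [_].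
  apply: le_lt_trans; rewrite le_eqVlt; apply/orP; left; apply/eqP.
  by apply: eq_measure_integral => A mA _; exact: distribution_indep_pair.
apply: integral0_eq => x _; rewrite /fubini_F/=.
under eq_integral do rewrite EFinM.
have dY : (distribution P Y).-integrable setT (EFin \o id).
  apply: (@integrable_pushforward _ _ _ _ _ Y _ P setT (EFin \o id)) => //.
  exact/measurable_EFinP.
rewrite (integralZl measurableT dY) (_ : (\int[_]_(_ in _) _)%E = 0%E) ?mule0//.
rewrite -[RHS]Y0 integral_distribution//.
exact/measurable_EFinP.
Qed.

End product.
End moment_norm.

(** * Past sigma-algebras of a family of variables, and martingale differences *)

Section history.
Context (disp : measure_display) (T : measurableType disp) (R : realType)
  (P : probability T R) (I : choiceType) (Z : I -> {RV P >-> R}).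
Implicit Types (E : set I).

(** Finite intersections are taken instead of single preimages so that the generating class is
    closed under intersection, as uniqueness of measures demands. *)
Definition cylinders E : set (set T) :=
  [set A | exists (J : {fset I}) (B : I -> set R),
    [/\ [set` J] `<=` E, forall i, i \in J -> measurable (B i) &
        A = \bigcap_(i in [set` J]) (Z i @^-1` B i)]].

Definition history E : set (set T) := <<s cylinders E >>.

Lemma setI_closed_cylinders E : setI_closed (cylinders E).
Proof.
move=> _ _ [J [B [JE mB ->]]] [K [C [KE mC ->]]].
(* Padding with the whole line outside [J] and outside [K] puts both cylinders on a common index
   set. *)
pose BC i := (if i \in J then B i else setT) `&` (if i \in K then C i else setT).
exists (J `|` K)%fset, BC; split.
- by move=> i /=; rewrite inE => /orP[/JE|/KE].
- move=> i _; apply: measurableI; case: ifPn => // iJ; [exact: mB|exact: mC].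
- apply/seteqP; split => [t [tB tC] i /= _|t tBC].
    by split; case: ifPn => // iJ; [exact: tB|exact: tC].
  split => i /= iJ; have := tBC i; rewrite /= inE iJ ?orbT => /(_ isT)[];
    by rewrite iJ.
Qed.

Lemma cylinders_measurable E : cylinders E `<=` @measurable _ T.
Proof.
move=> _ [J [B [_ mB ->]]]; apply: fin_bigcap_measurable => // i iJ.
by rewrite -[X in measurable X]setTI; apply: measurable_funP => //; exact: mB.
Qed.

Lemma cylindersT E : cylinders E setT.
Proof.
exists fset0, (fun=> setT); split => //; apply/seteqP; split => // t _ i /=.
Qed.

Lemma history_sigma_algebra E : sigma_algebra setT (history E).
Proof. exact: smallest_sigma_algebra. Qed.

Lemma history_measurable E : history E `<=` @measurable _ T.
Proof.
apply: smallest_sub; first exact: sigma_algebra_measurable.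
exact: cylinders_measurable.
Qed.

Lemma history_subset E E' : E `<=` E' -> history E `<=` history E'.
Proof.
move=> EE'; apply: sub_smallest2r; first exact: smallest_sigma_algebra.
move=> A [J [B [JE mB ->]]]; exists J, B; split => //.
exact: subset_trans EE'.
Qed.

Lemma history_RV E i : E i -> measurable_wrt (history E) (Z i).
Proof.
move=> Ei B mB; apply: sub_sigma_algebra; exists [fset i]%fset, (fun=> B).
split => // [j /=|]; first by rewrite inE => /eqP ->.
apply/seteqP; split => [t tB j /=|t]; first by rewrite inE => /eqP ->.
by apply; rewrite /= inE.
Qed.

(** Bridge to measurability of functions on the generated sigma-algebra, where closure under sums
    and products is available. *)
Lemma measurable_wrt_generated (G : set (set T)) (X : T -> R) :
  measurable_wrt <<s G >> X <->
  measurable_fun setT (X : g_sigma_algebraType G -> R).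
Proof.
split=> [mX _ B mB|mX B mB]; first by rewrite setTI; exact: mX.
by rewrite -[X in <<s _ >> X]setTI; exact: mX.
Qed.

Section independence.
Variable D : set I.
Hypothesis indepZ : independent_RVs D Z.

(** The event on [Z j] is one more constraint of the cylinder, at an index outside [J]. The product
    rule is applied to [J] enlarged by [j], then to [J] alone. *)
Lemma cylinders_indep E j A B : E `<=` D -> D j -> ~ E j -> measurable B ->
  cylinders E A -> P (A `&` Z j @^-1` B) = (P A * P (Z j @^-1` B))%E.
Proof.
move=> ED Dj nEj mB [J [C [JE mC ->]]].
have jJ : j \notin J by apply/negP => /JE.
pose C' i := if i == j then B else C i.
have C'E i : i \in J -> C' i = C i.
  by rewrite /C'; case: eqP => // -> jJ'; rewrite jJ' in jJ.
have -> : \bigcap_(i in [set` J]) (Z i @^-1` C i) `&` Z j @^-1` B =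
    \bigcap_(i in [set` (j |` J)%fset]) (Z i @^-1` C' i).
  apply/seteqP; split => [t [tC tB] i /=|t tC'].
    rewrite 2!inE => /orP[/eqP ->|iJ]; first by rewrite /C' eqxx.
    by rewrite C'E//; exact: tC.
  split => [i /= iJ|].
    by rewrite -C'E//; apply: tC'; rewrite /= 2!inE iJ orbT.
  by have := tC' j; rewrite /= 2!inE eqxx /C' eqxx => /(_ isT).
rewrite indepZ; last 2 first.
- by move=> i /=; rewrite 2!inE => /orP[/eqP -> //|/JE /ED].
- by move=> i; rewrite 2!inE /C'; case: eqP => //= _; exact: mC.
rewrite big_fsetU1//= muleC {2}/C' eqxx; congr (_ * _)%E.
rewrite indepZ//; last exact: subset_trans ED.
by apply: eq_big_seq => i iJ; rewrite C'E.
Qed.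

(** With [C] the event on [Z j], the finite measures sending [A] to the probability of its
    intersection with [C] and to [P A * P C] agree on cylinders. These are closed under intersection
    and include the whole space, so the measures agree on the generated sigma-algebra. *)
Lemma history_indep E j A B : E `<=` D -> D j -> ~ E j -> measurable B ->
  history E A -> P (A `&` Z j @^-1` B) = (P A * P (Z j @^-1` B))%E.
Proof.
move=> ED Dj nEj mB.
have mC : measurable (Z j @^-1` B).
  by rewrite -[X in measurable X]setTI; exact: measurable_funP.
have PC0 : 0 <= fine (P (Z j @^-1` B)) by rewrite fine_ge0.
move=> EA.
have PE C : mscale (NngNum PC0) P C = (P C * P (Z j @^-1` B))%E.
  by rewrite muleC -[in RHS](@fineK _ (P _))// fin_num_measure.
rewrite -PE; apply: (@g_sigma_algebra_measure_unique _ R T (cylinders E)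
  (@cylinders_measurable E) (fun=> setT) (fun=> cylindersT E) _
  (mrestr P mC) (mscale (NngNum PC0) P) (@setI_closed_cylinders E)) => //.
- by apply/seteqP; split => // t _; exists 0%N.
- by move=> C EC; rewrite [RHS]PE; exact: cylinders_indep EC.
- by move=> _; rewrite -ge0_fin_numE// fin_num_measure//; exact: measurableI.
Qed.

Lemma history_indep_pair E j X : E `<=` D -> D j -> ~ E j ->
  measurable_wrt (history E) X -> indep_pair P X (Z j).
Proof. by move=> ED Dj nEj mX A B mA mB; apply: (history_indep ED) => //; exact: mX. Qed.

(** Restricting to [A] amounts to replacing [Y] by [1_A Y], which still depends on the past only and
    is therefore independent of the centered [Z j]. *)
Lemma history_integral_mul0 E j (Y : {RV P >-> R}) A :
  E `<=` D -> D j -> ~ E j ->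
  measurable_wrt (history E) Y -> P.-integrable setT (EFin \o Y) ->
  centered P (Z j) -> history E A ->
  (\int[P]_(t in A) (Y t * Z j t)%:E = 0)%E.
Proof.
move=> ED Dj nEj mY iY [iZ Z0] EA.
have mA := history_measurable EA.
pose X := \1_A \* Y : T -> R.
have mX : measurable_fun setT X by apply: measurable_funM.
pose X' : {RV P >-> R} := HB.pack X (isMeasurableFun.Build _ _ _ _ _ mX).
have EX : measurable_wrt (history E) X.
  apply/measurable_wrt_generated/measurable_funM.
    exact: (@measurable_indic _ (g_sigma_algebraType (cylinders E))).
  exact/measurable_wrt_generated.
rewrite integral_mkcond -[RHS](@integral_indep_pair0 _ _ _ _ X' (Z j))//.
- apply: eq_integral => t _; rewrite patchE /X'/= /X/= indicE.
  by case: ifPn; rewrite ?mul1r ?mul0r.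
- exact: history_indep_pair EX.
- have := integrableS measurableT mA (@subsetT _ _) iY.
  move/(integrable_mkcond _ mA); apply: eq_integrable => // t _.
  by rewrite patchE /X'/= /X/= indicE; case: ifPn; rewrite ?mul1r ?mul0r.
Qed.

(** The index [l k] is revealed at time k: it lies in [E k] but not in [E k.-1]. The predictable
    factor [Y k] times the fresh centered variable thus integrates to zero over every past event. *)
Lemma history_martingale_differences (E : nat -> set I) (l : nat -> I) n
    (Y theta : nat -> {RV P >-> R}) :
  (forall k, E k `<=` D) -> (forall i j, (i <= j)%N -> E i `<=` E j) ->
  (forall k, indices (Some n) k ->
    [/\ E k (l k), ~ E k.-1 (l k), centered P (Z (l k)),
        measurable_wrt (history (E k.-1)) (Y k) &
        P.-integrable setT (EFin \o Y k)]) ->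
  (forall k, indices (Some n) k -> theta k = Y k \* Z (l k) :> (T -> R)) ->
  martingale_differences (history \o E) n theta.
Proof.
move=> ED Emono H thetaE; split.
  split => [i|i|i j ij]; [exact: history_sigma_algebra|exact: history_measurable|].
  by move=> A; apply: history_subset; exact: Emono.
move=> k nk; have [El nEl cZ mY iY] := H _ nk.
rewrite thetaE//; split.
  apply/measurable_wrt_generated/measurable_funM; apply/measurable_wrt_generated.
    by move=> B mB; apply: history_subset (mY _ mB); apply/Emono/leq_pred.
  exact: history_RV.
split.
- apply: (@integrable_indep_pair _ _ _ P (Y k) (Z (l k))) => //.
  + exact: (history_indep_pair (ED k.-1) (ED _ _ El) nEl mY).
  + by case: cZ.
- exact: finite_measure_integrable_cst.
- by apply/measurable_wrt_generated; exact: measurable_cst.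
- move=> A EA; rewrite integral0; apply/esym.
  exact: (history_integral_mul0 (ED k.-1) (ED _ _ El) nEl).
Qed.

End independence.
End history.

(** The whole space belongs to [F i.-1]; testing the conditional expectation on it gives mean
    zero. *)
Lemma martingale_differences_centered (disp : measure_display)
    (T : measurableType disp) (R : realType) (P : probability T R) F n
    (theta : nat -> {RV P >-> R}) i :
  martingale_differences F n theta -> indices (Some n) i -> centered P (theta i).
Proof.
move=> [[sF _ _] H] ni; have [_ [itheta _ _ H0]] := H _ ni; split => //.
rewrite unlock -H0 ?integral0//.
have [F0 FC _] := sF i.-1; have := FC _ F0.
by rewrite setD0.
Qed.

(** * Increasing tuples and polynomials, sorted by last index *)

Section incr_tuples.
Variable R : realType.
Implicit Types (d n k : nat).

Lemma incr_tuplesP d n (I : d.-tuple nat) : incr_tuples d (Some n) I <->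
  sorted ltn I /\ all (fun i => 1 <= i <= n)%N I.
Proof.
split=> -[sI nI]; split => //; first by apply/all_tnthP => m; apply/andP; exact: nI.
by move=> m; apply/andP; move/all_tnthP : nI; exact.
Qed.

Lemma incr_tuples_finite d n : finite_set (incr_tuples d (Some n)).
Proof.
pose f (J : d.-tuple 'I_n.+1) : d.-tuple nat := map_tuple (@nat_of_ord _) J.
have : finite_set (f @` setT) by apply: finite_image; exact: finite_finset.
apply: sub_finite_set => I /incr_tuplesP[_ /all_tnthP nI]; exists (map_tuple inord I) => //.
apply: eq_from_tnth => m; rewrite !tnth_map inordK// ltnS.
by have /andP[] := nI m.
Qed.

Lemma rcons_tuple_onto d (J : d.+1.-tuple nat) :
  exists (I : d.-tuple nat) k, J = [tuple of rcons I k].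
Proof.
case/tupleP: J => x s; exists (belast_tuple x s), (last x s).
by apply: val_inj; rewrite /= lastI.
Qed.

Lemma rcons_tuple_inj d k : injective (fun I : d.-tuple nat => [tuple of rcons I k]).
Proof.
move=> I J /(congr1 val)/= IJ; apply: val_inj => /=.
by have /rcons_inj[] := IJ.
Qed.

(** Strict growth keeps the entries before the last index [k] at or below [k - 1]; the bound
    [1 <= k] rules out truncation of [k.-1] at 0. *)
Lemma incr_tuples_rcons d n k (I : d.-tuple nat) :
  incr_tuples d.+1 (Some n) [tuple of rcons I k] <->
  (1 <= k <= n)%N /\ incr_tuples d (Some k.-1) I.
Proof.
split=> [/incr_tuplesP[]|[/andP[k0 kn] /incr_tuplesP[sI /allP kI]]].
  rewrite /= sorted_pairwise ?pairwise_rcons ?all_rcons; last exact: ltn_trans.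
  rewrite -sorted_pairwise; last exact: ltn_trans.
  move=> /andP[/allP Ik sI] /andP[kn /allP nI]; split => //.
  apply/incr_tuplesP; split => //; apply/allP => i iI.
  have := nI _ iI; have := Ik _ iI; move: kn => /andP[k0 _] ik /andP[-> _] /=.
  by rewrite -ltnS prednK.
apply/incr_tuplesP; rewrite /= sorted_pairwise; last exact: ltn_trans.
rewrite pairwise_rcons all_rcons k0 kn -sorted_pairwise; last exact: ltn_trans.
rewrite sI andbT; split; apply/allP => i /kI /andP[i0 ik]; first by rewrite /= -(prednK k0) ltnS.
by rewrite i0 (leq_trans ik)// (leq_trans (leq_pred _)).
Qed.

Lemma incr_tuplesS0 d : incr_tuples d.+1 (Some 0%N) = set0.
Proof.
apply/seteqP; split => // I; have [J [k ->]] := rcons_tuple_onto I.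
by move=> /incr_tuples_rcons[]; rewrite leqn0; case: k.
Qed.

Lemma incr_tuplesSS d n : incr_tuples d.+1 (Some n.+1) =
  incr_tuples d.+1 (Some n) `|`
  (fun I : d.-tuple nat => [tuple of rcons I n.+1]) @` incr_tuples d (Some n).
Proof.
apply/seteqP; split => I; have [J [k ->]] := rcons_tuple_onto I.
  move=> /incr_tuples_rcons[/andP[k0]]; rewrite leq_eqVlt => /predU1P[-> kJ|kn kJ].
    by right; exists J.
  by left; apply/incr_tuples_rcons; rewrite k0.
move=> [/incr_tuples_rcons[/andP[k0 kn] kJ]|[J' nJ' /(congr1 val)/= /rcons_inj[]]].
  by apply/incr_tuples_rcons; rewrite k0 leqW.
move=> /val_inj <- <-; apply/incr_tuples_rcons; split => //=.
Qed.

Lemma fsbig_incr_tuplesS d n (F : d.+1.-tuple nat -> R) :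
  \sum_(I \in incr_tuples d.+1 (Some n)) F I =
  \sum_(1 <= k < n.+1) \sum_(I \in incr_tuples d (Some k.-1))
    F [tuple of rcons I k].
Proof.
elim: n => [|n IHn]; first by rewrite incr_tuplesS0 fsbig_set0 big_geq.
rewrite big_nat_recr//= -IHn incr_tuplesSS fsbigU0; last 3 first.
- exact: incr_tuples_finite.
- exact/finite_image/incr_tuples_finite.
(* The two pieces are disjoint: a tuple ending in [n.+1] is not bounded by [n]. *)
- move=> _ [] /[swap] -[I _ <-] /incr_tuples_rcons[].
  by rewrite ltnn andbF.
rewrite fsbig_image// => I J _ _; exact: rcons_tuple_inj.
Qed.

Lemma fsbig_incr_tuples0 n (F : 0.-tuple nat -> R) :
  \sum_(I \in incr_tuples 0 (Some n)) F I = F [tuple].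
Proof.
rewrite (_ : incr_tuples 0 _ = [set [tuple]]) ?fsbig_set1//.
by apply/seteqP; split => [I _|I ->]; [exact: tuple0|apply/incr_tuplesP].
Qed.

End incr_tuples.

Section Qfin_rec.
Context (disp : measure_display) (T : measurableType disp) (R : realType)
  (P : probability T R).

Lemma QfinS d (xi : nat -> 'I_d.+1 -> {RV P >-> R}) (b : d.+1.-tuple nat -> R) n t :
  Qfin xi b n t = \sum_(1 <= k < n.+1)
    Qfin (fun i m => xi i (widen_ord (leqnSn d) m))
      (fun I => b [tuple of rcons I k]) k.-1 t * xi k ord_max t.
Proof.
rewrite /Qfin fsbig_incr_tuplesS; apply: eq_bigr => k _.
rewrite mulr_fsuml; apply: eq_fsbigr => I _.
rewrite big_ord_recr/= mulrA; congr (_ * _ * _).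
  by apply: eq_bigr => m _; rewrite !(tnth_nth 0%N)/= nth_rcons size_tuple ltn_ord.
by rewrite (tnth_nth 0%N)/= nth_rcons size_tuple ltnn eqxx.
Qed.

Lemma Qfin0 (xi : nat -> 'I_0 -> {RV P >-> R}) b n t : Qfin xi b n t = b [tuple].
Proof. by rewrite /Qfin fsbig_incr_tuples0 big_ord0 mulr1. Qed.

(** A zero sum of squares kills every coefficient on the index set. This serves the zero sections of
    [b] in the recursion, which cannot be normalised. *)
Lemma Qfin_eq0 d (xi : nat -> 'I_d -> {RV P >-> R}) b n t :
  \sum_(I \in incr_tuples d (Some n)) b I ^+ 2 = 0 -> Qfin xi b n t = 0.
Proof.
move=> /pfsumr_eq0 b0; apply: fsbig1 => I nI.
have /eqP := b0 (@incr_tuples_finite d n) (fun I _ => sqr_ge0 (b I)) I nI.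
by rewrite sqrf_eq0 => /eqP ->; rewrite mul0r.
Qed.

End Qfin_rec.

(** * Reindexing, scaling and measurability *)

Section bounds.
Context (disp : measure_display) (T : measurableType disp) (R : realType)
  (P : probability T R).

Lemma independent_RVs_comp (I J : choiceType) (D : set I) (D' : set J)
    (Z : I -> {RV P >-> R}) (f : J -> I) :
  independent_RVs D Z -> set_inj D' f -> f @` D' `<=` D ->
  independent_RVs D' (Z \o f).
Proof.
move=> indepZ injf fD' K A KD' mA.
have injK : {in K &, injective f}.
  by move=> i j iK jK; apply: injf; rewrite inE; exact: KD'.
(* The events are transported along [f] without an inverse: by injectivity on [K], the set at [f j]
   is exactly [A j]. *)
pose A' i := [set x | forall j, j \in K -> f j = i -> A j x].
have A'E j : j \in K -> A' (f j) = A j.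
  move=> jK; apply/seteqP; split => [x|x Ax k kK /injK]; first exact.
  by move=> ->.
have := indepZ (f @` K)%fset A'; rewrite big_imfset//=.
under [in RHS]eq_big_seq => j jK do rewrite A'E//.
move=> <-; last 2 first.
- by move=> _ /= /imfsetP[j jK ->]; apply: fD'; exists j => //; exact: KD'.
- by move=> _ /imfsetP[j jK ->]; rewrite A'E//; exact: mA.
congr (P _); apply/seteqP; split => [t tA _ /= /imfsetP[j jK ->]|t tA j /= jK].
  by rewrite A'E//; exact: tA.
by rewrite -A'E//; apply: tA; exact: in_imfset.
Qed.

Lemma independent_RVs_subset1 (I : choiceType) (D : set I) (Z : I -> {RV P >-> R}) :
  is_subset1 D -> independent_RVs D Z.
Proof.
move=> D1 J A JD mA; have [->|[j jJ]] := fset_0Vmem J.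
  rewrite big_seq_fset0 (_ : \bigcap_(_ in _) _ = setT) ?probability_setT//.
  by apply/seteqP; split.
have -> : J = [fset j]%fset.
  apply/fsetP => i; rewrite inE; apply/idP/eqP => [iJ|->//].
  by apply: D1; exact: JD.
rewrite big_seq_fset1; congr (P _); apply/seteqP; split => [t|t tA i /=].
  by apply; rewrite /= inE.
by rewrite inE => /eqP ->.
Qed.

Definition RV_of (X : T -> R) (mX : measurable_fun setT X) : {RV P >-> R} :=
  HB.pack X (isMeasurableFun.Build _ _ _ _ _ mX).

(** Admissibility of a real constant, as opposed to the extended infimum [KM], so that the induction
    can run on real numbers. *)
Definition martingale_bound (p K : R) := 0 <= K /\
  forall n (theta : nat -> {RV P >-> R}) F, martingale_differences F n theta ->
    (forall i, indices (Some n) i -> centered P (theta i)) ->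
    l2_moment_bound p K n theta.

Definition independent_bound (p K : R) := 0 <= K /\
  forall n (theta : nat -> {RV P >-> R}),
    independent_RVs (indices (Some n)) theta ->
    (forall i, indices (Some n) i -> centered P (theta i)) ->
    l2_moment_bound p K n theta.

Lemma esup0_le (A : set (\bar R)) (x : \bar R) :
  (0 <= x)%E -> (forall y, A y -> (y <= x)%E) -> (esup0 A <= x)%E.
Proof. by move=> x0 Ax; apply: ge_ereal_sup => y [->//|/Ax]. Qed.

Lemma le_esup0 (A : set (\bar R)) (x : \bar R) : A x -> (x <= esup0 A)%E.
Proof. by move=> Ax; apply: ereal_sup_ubound; right. Qed.

Lemma esup0_ge0 (A : set (\bar R)) : (0 <= esup0 A)%E.
Proof. by apply: ereal_sup_ubound; left. Qed.

(** Homogeneous form of the inequality: division by the l2 norm of [b] reduces it to unit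
    coefficients, and [c] bounds the supremum of the norms. *)
Lemma l2_moment_bound_scaled (p K c : R) n (theta : nat -> {RV P >-> R}) (b : nat -> R) :
  0 < p -> 0 <= K -> 0 <= c -> l2_moment_bound p K n theta ->
  (forall i, indices (Some n) i -> (rv_norm P p (theta i) <= c%:E)%E) ->
  (rv_norm P p (fun t => \sum_(1 <= i < n.+1) b i * theta i t)%R <=
   (K * c * Num.sqrt (\sum_(1 <= i < n.+1) b i ^+ 2))%:E)%E.
Proof.
move=> p0 K0 c0 Ktheta thetac; set S := \sum_(_ <= _ < _) b _ ^+ 2.
have S0 : 0 <= S by apply: sumr_ge0 => i _; exact: sqr_ge0.
(* For [S = 0] no normalisation is possible, but all coefficients and both sides vanish. *)
have [SE|SN0] := eqVneq S 0.
  rewrite (_ : (fun t => _) = cst 0) ?rv_norm_cst0 ?SE ?sqrtr0 ?mulr0//.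
  apply/funext => t /=; apply: big1_seq => i /andP[_ ni].
  move/eqP : SE; rewrite psumr_eq0 => [/allP/(_ _ ni)|j _]; last exact: sqr_ge0.
  by rewrite /= sqrf_eq0 => /eqP ->; rewrite mul0r.
have sS0 : 0 < Num.sqrt S by rewrite sqrtr_gt0 lt_def SN0.
pose b' i := b i / Num.sqrt S.
have b'1 : \sum_(1 <= i < n.+1) b' i ^+ 2 = 1.
  under eq_bigr do rewrite expr_div_n sqr_sqrtr//.
  by rewrite -mulr_suml divff.
rewrite (_ : (fun t => _) =
    (fun t => Num.sqrt S * \sum_(1 <= i < n.+1) b' i * theta i t)); last first.
  apply/funext => t; rewrite mulr_sumr; apply: eq_bigr => i _.
  by rewrite mulrA /b' mulrCA divff ?mulr1// gt_eqF.
rewrite rv_normZ//; last first.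
  by apply: measurable_sum => i; exact/measurable_funM/measurable_funP.
rewrite gtr0_norm// mulrC EFinM lee_pmul2l// (le_trans (Ktheta _ b'1))//.
rewrite EFinM lee_wpmul2l ?lee_fin//; apply: esup0_le; rewrite ?lee_fin//.
by move=> _ [i ni <-]; exact: thetac.
Qed.

Lemma measurable_big_sum d (U : measurableType d) (I : eqType) (s : seq I)
    (h : I -> U -> R) : (forall i, i \in s -> measurable_fun setT (h i)) ->
  measurable_fun setT (fun x => \sum_(i <- s) h i x).
Proof.
elim: s => [_|i s IHs mh].
  by under eq_fun do rewrite big_nil; exact: measurable_cst.
under eq_fun do rewrite big_cons; apply: measurable_funD.
  by apply: mh; rewrite inE eqxx.
by apply: IHs => j js; apply: mh; rewrite inE js orbT.
Qed.

Section polynomial.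
Context d (xi : nat -> 'I_d -> {RV P >-> R}).

Lemma measurable_wrt_Qfin (G : set (set T)) b n :
  (forall i m, (1 <= i <= n)%N -> measurable_wrt <<s G >> (xi i m)) ->
  measurable_wrt <<s G >> (Qfin xi b n).
Proof.
move=> xiG; apply/measurable_wrt_generated.
rewrite (_ : Qfin xi b n = (fun t => \sum_(I <- fset_set (incr_tuples d (Some n)))
    (b I * \prod_(m < d) xi (tnth I m) m t))); last first.
  by apply/funext => t; rewrite /Qfin fsbig_finite//; exact: incr_tuples_finite.
apply: measurable_big_sum => I.
rewrite in_fset_set ?inE; last exact: incr_tuples_finite.
move=> [_ nI]; apply: measurable_funM; first exact: measurable_cst.
apply: measurable_prod => m _; apply/measurable_wrt_generated.
by apply: xiG; apply/andP; exact: nI.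
Qed.

(** The measurable sets form a sigma-algebra generated by itself, so the relative statement applies
    to them. *)
Lemma measurable_Qfin b n : measurable_fun setT (Qfin xi b n).
Proof.
move=> _ B mB; rewrite setTI.
rewrite -(sigma_algebra_id (@sigma_algebra_measurable _ T)).
apply: measurable_wrt_Qfin mB => i m _ A mA; apply: sub_sigma_algebra.
by rewrite -[X in measurable X]setTI; exact: measurable_funP.
Qed.

End polynomial.

End bounds.

(** * Moment bound for finite polynomials, by induction on the degree *)

Section polynomial_bound.
Context (disp : measure_display) (T : measurableType disp) (R : realType)
  (P : probability T R) (o : option nat) (p K1 K2 : R).
Hypotheses (p1 : 1 <= p) (K1_bound : independent_bound P p K1).

Lemma rv_norm_Qfin1 (xi : nat -> 'I_1 -> {RV P >-> R}) (c : 'I_1 -> R) n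
    (b : 1.-tuple nat -> R) :
  (forall i m, indices o i -> centered P (xi i m)) ->
  independent_RVs [set im : nat * 'I_1 | indices o im.1]
    (fun im => xi im.1 im.2) ->
  (forall i m, indices o i -> (rv_norm P p (xi i m) <= (c m)%:E)%E) ->
  (forall m, 0 <= c m) -> indices (Some n) `<=` indices o ->
  (rv_norm P p (Qfin xi b n) <=
   (K1 * c ord_max * Num.sqrt (\sum_(I \in incr_tuples 1 (Some n)) b I ^+ 2))%:E)%E.
Proof.
move=> cxi ixi xic c0 no; have [K10 K1P] := K1_bound.
pose b' k := b [tuple of rcons [tuple] k].
rewrite (_ : Qfin xi b n = (fun t => \sum_(1 <= i < n.+1) b' i * xi i ord_max t)).
  rewrite fsbig_incr_tuplesS; under [in leRHS]eq_bigr do rewrite fsbig_incr_tuples0.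
  apply: l2_moment_bound_scaled => //; first exact: lt_le_trans p1.
    apply: K1P => [|i /no/cxi //].
    (* The single column is extracted from the independent array along the injection
       [i -> (i, ord_max)]. *)
    apply: (@independent_RVs_comp _ _ _ P _ _ _ _ _ (fun i => (i, ord_max)) ixi).
      by move=> i j _ _ [].
    by move=> _ [i /no ni <-].
  by move=> i /no/xic.
by apply/funext => t; rewrite QfinS; apply: eq_bigr => k _; rewrite Qfin0.
Qed.

(** The l2 norm of [b] is kept as a factor because the sections met in the induction are not
    normalised. The bound [o] stays fixed while [n] varies, so that one statement covers all partial
    sums of an infinite polynomial. *)
Lemma rv_norm_Qfin d (xi : nat -> 'I_d.+1 -> {RV P >-> R}) (c : 'I_d.+1 -> R) n
    (b : d.+1.-tuple nat -> R) :
  ((0 < d)%N -> martingale_bound P p K2) ->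
  (forall i m, indices o i -> centered P (xi i m)) ->
  independent_RVs [set im : nat * 'I_d.+1 | indices o im.1]
    (fun im => xi im.1 im.2) ->
  (forall i m, indices o i -> (rv_norm P p (xi i m) <= (c m)%:E)%E) ->
  (forall m, 0 <= c m) -> indices (Some n) `<=` indices o ->
  (rv_norm P p (Qfin xi b n) <=
   (K1 * K2 ^+ d * \prod_(m < d.+1) c m *
    Num.sqrt (\sum_(I \in incr_tuples d.+1 (Some n)) b I ^+ 2))%:E)%E.
Proof.
have p0 : 0 < p by exact: lt_le_trans p1.
have [K10 _] := K1_bound.
elim: d xi c n b => [|d IHd] xi c n b K2P cxi ixi xic c0 no.
  rewrite expr0 mulr1 big_ord1 (_ : ord0 = ord_max); first exact: rv_norm_Qfin1.
  exact: val_inj.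
have [K20 K2m] := K2P isT.
pose wid (im : nat * 'I_d.+1) : nat * 'I_d.+2 := (im.1, widen_ord (leqnSn _) im.2).
pose xi' i m := xi i (widen_ord (leqnSn d.+1) m).
have ixi' : independent_RVs [set im : nat * 'I_d.+1 | indices o im.1]
    (fun im => xi' im.1 im.2).
  apply: (@independent_RVs_comp _ _ _ P _ _ _ _ _ wid ixi).
    by move=> [i m] [j l] _ _ [/= -> /ord_inj ->].
  by move=> _ [im oi <-].
(* The induction bound for the first [d.+1] columns, without the l2 factor. *)
pose C := K1 * K2 ^+ d * \prod_(m < d.+1) c (widen_ord (leqnSn _) m).
have C0 : 0 <= C by rewrite !mulr_ge0 ?exprn_ge0 ?prodr_ge0.
(* [bk k] is the section of [b] with last index [k], and [S k] is its squared l2 norm over tuples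
   bounded by [k.-1]. *)
pose bk k (I : d.+1.-tuple nat) := b [tuple of rcons I k].
pose S k := \sum_(I \in incr_tuples d.+1 (Some k.-1)) bk k I ^+ 2.
have S0 k : 0 <= S k by apply: fsumr_ge0 => I _; exact: sqr_ge0.
have YC k : indices (Some n) k ->
    (rv_norm P p (Qfin xi' (bk k) k.-1) <= (C * Num.sqrt (S k))%:E)%E.
  move=> [k1 kn]; apply: (IHd xi' (c \o widen_ord (leqnSn d.+1))).
  - by move=> _; exact: K2P.
  - by move=> i m; exact: cxi.
  - exact: ixi'.
  - by move=> i m; exact: xic.
  - by move=> m; exact: c0.
  - by move=> i [i1 ik]; apply: no; split; rewrite ?(leq_trans ik)// (leq_trans (leq_pred _)).
(* If S k = 0, the junk value 0^-1 = 0 makes Y k, hence theta k, vanish. *)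
pose Yf k t := (Num.sqrt (S k))^-1 * Qfin xi' (bk k) k.-1 t.
have mY k : measurable_fun setT (Yf k).
  by apply: measurable_funM => //; exact: measurable_Qfin.
pose Y k := RV_of P (mY k).
have Ybound k : indices (Some n) k -> (rv_norm P p (Y k) <= C%:E)%E.
  move=> nk; rewrite [leLHS]rv_normZ//; last exact: measurable_Qfin.
  rewrite ger0_norm ?invr_ge0 ?sqrtr_ge0//.
  have [->|/eqP SN0] := eqVneq (Num.sqrt (S k)) 0; first by rewrite invr0 mul0e lee_fin.
  apply: (@le_trans _ _ ((Num.sqrt (S k))^-1%:E * (C * Num.sqrt (S k))%:E)%E).
    by rewrite lee_wpmul2l ?YC// lee_fin invr_ge0 sqrtr_ge0.
  by rewrite -EFinM lee_fin mulrC mulfK//; exact/eqP.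
have mtheta k : measurable_fun setT (Yf k \* xi k ord_max) by exact: measurable_funM.
pose theta k := RV_of P (mtheta k).
pose D := [set im : nat * 'I_d.+2 | indices o im.1].
pose Z (im : nat * 'I_d.+2) := xi im.1 im.2.
(* The past at time [k] holds the rows up to [k] in every column, so row [k], and with it
   [(k, ord_max)], is absent from [E k.-1]. *)
pose E k := [set im : nat * 'I_d.+2 | indices o im.1 /\ (im.1 <= k)%N].
have ED k : E k `<=` D by move=> im [].
have EY k : indices (Some n) k -> measurable_wrt (history Z (E k.-1)) (Y k).
  move=> [k1 kn]; apply/measurable_wrt_generated/measurable_funM => //.
  apply/measurable_wrt_generated => B mB.
  apply: measurable_wrt_Qfin mB => i m /andP[i1 ik].
  apply: (@history_RV _ _ _ _ _ Z _ (i, widen_ord (leqnSn d.+1) m)); split => //.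
  by apply: no; split => //=; rewrite (leq_trans ik)// (leq_trans (leq_pred _)).
have Dk k : indices (Some n) k -> D (k, ord_max) by move=> /no.
have nEk k : indices (Some n) k -> ~ E k.-1 (k, ord_max).
  by move=> [k1 _] [_ /=]; rewrite leqNgt prednK// leqnn.
have mds : martingale_differences (history Z \o E) n theta.
  apply: (@history_martingale_differences _ _ _ P _ Z D _ E (fun k => (k, ord_max)) n Y).
  - exact: ixi.
  - exact: ED.
  - by move=> i j ij im [oi imi]; split => //; exact: leq_trans ij.
  - move=> k nk; split.
    + by split => //; exact: no.
    + exact: nEk.
    + exact/cxi/no.
    + exact: EY.
    (* The finite p-th moment bound on [Y k] yields integrability because [1 <= p]. *)
    + apply: (integrable_rv_norm p1) => //.
      by apply: le_lt_trans (Ybound _ nk) _; rewrite ltry.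
  - by [].
have thetaC k : indices (Some n) k ->
    (rv_norm P p (theta k) <= (C * c ord_max)%:E)%E.
  move=> nk; rewrite [leLHS](@rv_norm_indep_pair _ _ _ P (Y k) (xi k ord_max)); last first.
    exact: (history_indep_pair ixi (ED k.-1) (Dk _ nk) (nEk _ nk) (EY _ nk)).
  rewrite EFinM lee_pmul ?rv_norm_ge0 ?Ybound//.
  exact/xic/no.
rewrite (_ : Qfin xi b n =
    (fun t => \sum_(1 <= k < n.+1) Num.sqrt (S k) * theta k t)); last first.
  apply/funext => t; rewrite QfinS; apply: eq_bigr => k _.
  rewrite /theta/= /Yf mulrA; have [SE|SN0] := eqVneq (S k) 0.
    by have -> := Qfin_eq0 xi' t SE; rewrite SE sqrtr0 !mul0r.
  by rewrite mulVKf// gt_eqF// sqrtr_gt0 lt_def SN0 S0.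
have := l2_moment_bound_scaled (fun k => Num.sqrt (S k)) p0 K20
  (mulr_ge0 C0 (c0 _)) (K2m _ _ _ mds
    (fun i => martingale_differences_centered mds)) thetaC.
(* The squared coefficients [S k] add up to the sum of squares of [b], by the same grouping by last
   index. *)
congr (_ <= _%:E)%E; rewrite fsbig_incr_tuplesS.
under eq_bigr do rewrite sqr_sqrtr//.
by rewrite big_ord_recr /= exprS /C; ring.
Qed.

End polynomial_bound.

(** * Passage to the limit by Fatou's lemma *)

Lemma cvg_powR (R : realType) (u : R^nat) (x p : R) : 0 < p ->
  (forall k, 0 <= u k) -> u k @[k --> \oo] --> x ->
  u k `^ p @[k --> \oo] --> x `^ p.
Proof.
move=> p0 u0 ux.
have x0 : 0 <= x by rewrite -(cvg_lim _ ux)//; apply: limr_ge; [exact: cvgP ux|exact: nearW].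
(* Differentiability of the power is invoked only at a positive limit; at 0 the threshold [e^(1/p)]
   for [u k] is used instead. *)
move: x0; rewrite le_eqVlt => /predU1P[xE|x0].
  rewrite -xE powR0 ?gt_eqF//; apply/cvgr0Pnorm_lt => e e0.
  have e'0 : 0 < e `^ p^-1 by exact: powR_gt0.
  rewrite -xE in ux; have /cvgr0Pnorm_lt /(_ _ e'0) := ux.
  apply: filterS => k; rewrite !ger0_norm ?powR_ge0// => uke.
  have -> : e = (e `^ p^-1) `^ p by rewrite -powRrM mulVf ?gt_eqF// powRr1// ltW.
  by apply: gt0_ltr_powR; rewrite ?nnegrE ?powR_ge0.
have /differentiable_continuous px : differentiable (fun a : R => a `^ p) x.
  by apply/derivable1_diffP; apply: derivable_powR; rewrite in_itv/= x0.
exact: (cvg_comp _ _ ux px).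
Qed.

Section fatou.
Context (disp : measure_display) (T : measurableType disp) (R : realType)
  (P : probability T R).

Lemma rv_norm_ae_cvg (p : R) (M : \bar R) (Q : nat -> T -> R) (X : T -> R) :
  0 < p -> (forall k, measurable_fun setT (Q k)) -> measurable_fun setT X ->
  {ae P, forall t, Q k t @[k --> \oo] --> X t} ->
  (forall k, (rv_norm P p (Q k) <= M)%E) -> (rv_norm P p X <= M)%E.
Proof.
move=> p0 mQ mX QX QM.
have M0 : (0 <= M)%E by apply: le_trans (QM 0%N); exact: rv_norm_ge0.
have pN0 : p != 0 by rewrite gt_eqF.
have powM x y : (0 <= x -> x <= y -> x `^ p <= y `^ p)%E.
  move=> x0 xy; apply: gt0_ler_poweR => //; rewrite ?in_itv/= ?leey ?andbT//.
    exact: ltW.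
  exact: le_trans xy.
suff : (\int[P]_t (`|X t| `^ p)%:E <= M `^ p)%E.
  rewrite rv_normE => XM; rewrite -[leRHS]poweRe1// -(mulfV pN0) poweRrM.
  apply: gt0_ler_poweR => //; rewrite ?invr_ge0 ?ltW// in_itv/= leey andbT.
    by apply: integral_ge0 => t _; rewrite lee_fin powR_ge0.
  exact: poweR_ge0.
pose f k t := (`|Q k t| `^ p)%:E.
have mf k : measurable_fun setT (f k).
  by apply/measurable_EFinP; exact: measurable_abs_powR.
have f0 k t : (0 <= f k t)%E by rewrite lee_fin powR_ge0.
(* Almost everywhere [|X|^p] equals the lower limit of the [f k], to which Fatou's lemma applies. *)
rewrite (@ge0_ae_eq_integral _ _ _ P setT _ (fun t => limn_einf (f^~ t)))//.
- apply: le_trans; first by apply: fatou.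
  rewrite limn_einf_lim; apply: lime_le; first exact: is_cvg_einfs.
  apply: nearW => k; apply: (@le_trans _ _ (\int[P]_t f k t)%E).
    by apply: ereal_inf_lbound; exists k => /=.
  apply: le_trans (powM _ _ (rv_norm_ge0 _ _ _) (QM k)).
  by rewrite rv_normE -poweRrM mulVf// poweRe1// integral_ge0.
- by apply/measurable_EFinP; exact: measurable_abs_powR.
- apply: measurableT_comp => //; apply: measurable_fun_limn_esup => k.
  exact: measurableT_comp.
- move=> t _; rewrite limn_einf_lim; apply: lime_ge; first exact: is_cvg_einfs.
  by apply: nearW => k; apply: le_ereal_inf_tmp => _ [j _ <-].
- apply: filterS QX => t QXt _.
  have fX : f k t @[k --> \oo] --> (`|X t| `^ p)%:E.
    apply: cvg_EFin; first exact: nearW.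
    by apply: cvg_powR => //; exact: cvg_norm.
  by have [-> _] := cvg_limn_einf_sup fX.
Qed.
End fatou.

(** * The best constants: attainment and lower bounds *)

Section best_constants.
Context (disp : measure_display) (T : measurableType disp) (R : realType)
  (P : probability T R).

(** For positive real [y], divide by [y] and pass to the infimum. For [y = +oo] positivity of [k]
    makes the right side infinite, and for [y = 0] any one element of [A] suffices; [A] is nonempty
    since its infimum is finite. *)
Lemma le_ereal_inf_mule (A : set R) (k : R) (x y : \bar R) :
  ereal_inf (EFin @` A) = k%:E -> 0 < k -> (0 <= y)%E ->
  (forall K, A K -> (x <= K%:E * y)%E) -> (x <= k%:E * y)%E.
Proof.
move=> Ak k0 y0 xAy.
have [K AK] : A !=set0.
  apply/set0P/negP => /eqP A0; move: Ak.
  by rewrite A0 image_set0 ereal_inf0.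
case: y y0 xAy => [y| |//] y0 xAy; last by rewrite gt0_muley ?lte_fin// leey.
move: y0; rewrite lee_fin le_eqVlt => /predU1P[y0|y0].
  by have := xAy _ AK; rewrite -y0 !mule0.
rewrite -lee_pdivrMr// -Ak; apply: le_ereal_inf_tmp => _ [L AL <-].
by rewrite lee_pdivrMr//; exact: xAy.
Qed.

Lemma KI_attained (p k : R) : KI P p = k%:E -> 0 < k -> independent_bound P p k.
Proof.
move=> pk k0; split; first exact: ltW.
move=> n theta itheta ctheta b b1.
apply: le_ereal_inf_mule pk k0 (esup0_ge0 _) _ => K [_ KP].
exact: KP.
Qed.

Lemma KM_attained (p k : R) : KM P p = k%:E -> 0 < k -> martingale_bound P p k.
Proof.
move=> pk k0; split; first exact: ltW.
move=> n theta F mtheta ctheta b b1.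
apply: le_ereal_inf_mule pk k0 (esup0_ge0 _) _ => K [_ KP].
exact: KP mtheta ctheta _ b1.
Qed.

Section nontrivial_variable.
Variables (p : R) (X : {RV P >-> R}).
Hypotheses (cX : centered P X) (X0 : (0 < rv_norm P p X)%E)
  (Xoo : (rv_norm P p X < +oo)%E).

(** A single summand with coefficient 1 gives [|X|_p <= K |X|_p], where the norm is positive and
    finite and cancels. *)
Lemma l2_moment_bound_ge1 (K : R) : 0 <= K -> l2_moment_bound p K 1 (fun=> X) -> 1 <= K.
Proof.
move=> K0 /(_ (fun=> 1)); rewrite big_nat1 expr1n => /(_ erefl).
under eq_fun do rewrite big_nat1 mul1r.
move=> XK; have {XK} : (rv_norm P p X <= K%:E * rv_norm P p X)%E.
  apply: le_trans XK _; rewrite lee_wpmul2l ?lee_fin//.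
  by apply: esup0_le; [exact: ltW|move=> _ [i _ <-]].
have : rv_norm P p X \is a fin_num by rewrite ge0_fin_numE// ltW.
move: X0; case: (rv_norm P p X) => // x; rewrite lte_fin => x0 _.
by rewrite -EFinM lee_fin -ler_pdivrMr// divff// gt_eqF.
Qed.

(* The bounds KI_ge1 and KM_ge1 exclude the junk products 0 * oo in zeta. *)
Lemma KI_ge1 : (1 <= KI P p)%E.
Proof.
apply: le_ereal_inf_tmp => _ [K [K0 KP] <-]; rewrite lee_fin.
apply: l2_moment_bound_ge1 => //; apply: KP => //.
apply: independent_RVs_subset1 => i j [i1 i1'] [j1 j1'].
by apply/eqP; rewrite eqn_leq (leq_trans i1')// (leq_trans j1').
Qed.

Lemma KM_ge1 : (1 <= KM P p)%E.
Proof.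
apply: le_ereal_inf_tmp => _ [K [K0 KP] <-]; rewrite lee_fin.
apply: l2_moment_bound_ge1 => //.
pose Z := fun _ : unit => X.
(* The past is trivial at time 0 and contains [X] from time 1 on; the predictable factor is the
   constant 1. *)
pose E k : set unit := [set _ | (0 < k)%N].
have iZ : independent_RVs setT Z by apply: independent_RVs_subset1 => -[] [].
have m1 : measurable_fun setT (cst 1 : T -> R) by exact: measurable_cst.
have mX : martingale_differences (history Z \o E) 1 (fun=> X).
  apply: (@history_martingale_differences _ _ _ P _ Z setT iZ E (fun=> tt) 1
      (fun=> RV_of P m1)) => //.
  - by move=> i j ij u; rewrite /E/= => /leq_trans; apply.
  - move=> k [k1 k1']; have -> : k = 1%N by apply/eqP; rewrite eqn_leq k1'.
    split => //.
    + by apply/measurable_wrt_generated; exact: measurable_cst.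
    + exact: finite_measure_integrable_cst.
  - by move=> k _; apply/funext => t /=; rewrite mul1r.
by apply: KP mX _.
Qed.

End nontrivial_variable.
End best_constants.

(** * Comparison with zeta, and the norm inequality *)

Section zeta_bound.
Context (disp : measure_display) (T : measurableType disp) (R : realType)
  (P : probability T R).

Lemma fsum_sqr_le1 d n k (b : d.-tuple nat -> R) :
  unit_arrays R d n b -> indices (Some k) `<=` indices n ->
  \sum_(I \in incr_tuples d (Some k)) b I ^+ 2 <= 1.
Proof.
move=> b1 kn; rewrite -lee_fin -b1; apply: esum_ge.
exists (incr_tuples d (Some k)).
  split; first exact: incr_tuples_finite.
  by move=> I [sI kI]; split => // m; exact: kn.
rewrite fsbig_finite//= ?fsbig_finite//=; try exact: incr_tuples_finite.
by rewrite sumEFin.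
Qed.

(** The value [z = +oo], which zeta takes when a best constant is infinite, is included: its inverse
    is 0. *)
Lemma dive_le1 (x z : \bar R) : (0 < z)%E -> (x <= z)%E -> (x / z <= 1)%E.
Proof.
case: z => [z| |//]; rewrite ?lte_fin => z0 xz; last by rewrite invey mule0.
by rewrite inver gt_eqF// lee_pdivrMr// mul1e.
Qed.

(** At the midpoint of the nonempty interval [(2, r)] the function is positive and finite, so its
    ratio to itself is 1. *)
Lemma Gnorm_self_ge1 (r : R) (nu : R -> \bar R) :
  classG r nu -> (1 <= Gnorm nu r%:E nu)%E.
Proof.
move=> [r2 _ nu0 _ _]; apply: le_esup0; exists ((2 + r) / 2).
  by rewrite /= lte_fin; split; lra.
have /nu0/andP[nu_gt0 nu_lty] : 1 <= (2 + r) / 2 < r by apply/andP; split; lra.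
by rewrite divee ?gt_eqF// ge0_fin_numE// ltW.
Qed.

Lemma rv_norm_is_Q d (n : option nat) (xi : nat -> 'I_d -> {RV P >-> R})
    (p : R) (b : d.-tuple nat -> R) (M : \bar R) (X : T -> R) :
  0 < p ->
  (forall k, indices (Some k) `<=` indices n ->
    (rv_norm P p (Qfin xi b k) <= M)%E) ->
  is_Q xi n b X -> (rv_norm P p X <= M)%E.
Proof.
move=> p0; case: n => [n|] QM; first by move=> ->; exact: QM.
move=> [mX QX]; apply: (rv_norm_ae_cvg p0 _ mX QX) => k.
  exact: measurable_Qfin.
by apply: QM => i [].
Qed.

Lemma rv_norm_le_zeta d (n : option nat) (xi : nat -> 'I_d.+1 -> {RV P >-> R})
    (p : R) (b : d.+1.-tuple nat -> R) (X : T -> R) :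
  1 <= p ->
  (forall i m, indices n i -> centered P (xi i m)) ->
  independent_RVs [set im : nat * 'I_d.+1 | indices n im.1]
    (fun im => xi im.1 im.2) ->
  (forall m, 0 < sup_norm xi n m p < +oo)%E ->
  unit_arrays R d.+1 n b -> is_Q xi n b X ->
  (0 < zeta xi n p /\ rv_norm P p X <= zeta xi n p)%E.
Proof.
move=> p1 cxi ixi nup b1 QX.
have p0 : 0 < p by exact: lt_le_trans p1.
pose c m := fine (sup_norm xi n m p).
have cE m : sup_norm xi n m p = (c m)%:E.
  by have /andP[n0 noo] := nup m; rewrite /c fineK// ge0_fin_numE// ltW.
have c0 m : 0 < c m by rewrite -lte_fin -cE; have /andP[] := nup m.
have xic i m : indices n i -> (rv_norm P p (xi i m) <= (c m)%:E)%E.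
  by move=> ni; rewrite -cE; apply: le_esup0; exists i.
(* A positive supremum supplies a nonzero variable in the first column, on which the lower bounds
   for both constants rest. *)
have [i ni xi0] : exists2 i, indices n i & (0 < rv_norm P p (xi i ord0))%E.
  apply: contrapT => noxi; have /andP[+ _] := nup ord0; apply/negP.
  rewrite -leNgt; apply: esup0_le => // _ [i ni <-]; rewrite leNgt.
  by apply/negP => xi0; apply: noxi; exists i.
have xioo : (rv_norm P p (xi i ord0) < +oo)%E.
  by apply: le_lt_trans (xic _ _ ni) _; rewrite ltry.
have KI1 := KI_ge1 (cxi _ _ ni) xi0 xioo.
have KM1 := KM_ge1 (cxi _ _ ni) xi0 xioo.
have KI0 : (0 < KI P p)%E by exact: lt_le_trans KI1.
have KM0 : (0 < KM P p)%E by exact: lt_le_trans KM1.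
have prodE : (\prod_(m < d.+1) sup_norm xi n m p = (\prod_(m < d.+1) c m)%:E)%E.
  rewrite (big_morph EFin EFinM erefl).
  by apply: eq_bigr => m _; exact: cE.
have prod0 : (0 < (\prod_(m < d.+1) c m)%:E)%E by rewrite lte_fin prodr_gt0.
have zetaE : zeta xi n p = (KI P p * KM P p ^+ d * (\prod_(m < d.+1) c m)%:E)%E.
  by rewrite /zeta prodE.
rewrite zetaE; split; first by rewrite !mule_gt0 ?expe_gt0.
(* If [KI] is infinite, so is zeta, its other factors being positive. *)
have [->|KIoo] := eqVneq (KI P p) +oo%E.
  by rewrite !gt0_mulye ?leey ?expe_gt0.
have KIE : KI P p = (fine (KI P p))%:E by rewrite fineK// ge0_fin_numE ?ltey// ltW.
have K1P : independent_bound P p (fine (KI P p)).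
  by apply: KI_attained => //; rewrite -lte_fin -KIE.
(* An infinite [KM] makes zeta infinite only for [0 < d]; for [d = 0] its power is 1. *)
have [[d0 KMoo]|KMfin] : (0 < d)%N /\ KM P p = +oo%E \/ ((0 < d)%N -> KM P p \is a fin_num).
  have [KMoo|KMoo] := eqVneq (KM P p) +oo%E.
    by case: (d) => [|k]; [right|left].
  by right=> _; rewrite ge0_fin_numE ?ltey// ltW.
  have -> : (KM P p ^+ d = +oo)%E.
    by rewrite KMoo; case: (d) d0 => // k _; rewrite expeS gt0_mulye// expe_gt0.
  by rewrite gt0_muley// gt0_mulye// leey.
have K2P : (0 < d)%N -> martingale_bound P p (fine (KM P p)).
  move=> /KMfin KMf; apply: KM_attained; first by rewrite fineK.
  by rewrite -lte_fin fineK.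
have -> : (KM P p ^+ d = (fine (KM P p) ^+ d)%:E)%E.
  case: (d) KMfin => [//|k] /(_ isT) KMf.
  by rewrite EFin_expe fineK.
rewrite KIE -!EFinM; set C := (X in X%:E).
have C0 : 0 <= C.
  by rewrite !mulr_ge0 ?exprn_ge0 ?fine_ge0 ?prodr_ge0 ?ltW// => m _; exact: ltW.
have QC k : indices (Some k) `<=` indices n -> (rv_norm P p (Qfin xi b k) <= C%:E)%E.
  move=> kn; apply: le_trans.
    by apply: (rv_norm_Qfin p1 K1P b K2P cxi ixi xic _ kn) => m; exact: ltW.
  rewrite lee_fin -[leRHS]mulr1 ler_wpM2l//.
  by rewrite -[leRHS]sqrtr1 ler_wsqrtr// (fsum_sqr_le1 b1).
exact: rv_norm_is_Q p0 QC QX.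
Qed.

End zeta_bound.

Theorem theorem4p1 (disp : measure_display) (T : measurableType disp)
    (R : realType) (P : probability T R)
    (d : nat) (hd : (1 <= d)%N)
    (n : option nat) (hn : n <> Some 0%N)
    (xi : nat -> 'I_d -> {RV P >-> R})
    (hcentered : forall i m, indices n i -> centered P (xi i m))
    (hindep : independent_RVs [set im : nat * 'I_d | indices n im.1]
                (fun im => xi im.1 im.2))
    (r : 'I_d -> R)
    (hnu : forall m, classG (r m) (sup_norm xi n m)) :
  let s := \big[Order.min/+oo%E]_(m < d) (r m)%:E in
  (esup0 [set Gnorm (zeta xi n) s (fun p => rv_norm P p X)
         | X in [set X | exists2 b, unit_arrays R d n b & is_Q xi n b X]]
   <= \prod_(m < d)
        Gnorm (sup_norm xi n m) (r m)%:E (sup_norm xi n m))%E.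
Proof.
case: d hd xi hcentered hindep r hnu => [//|d] _ xi cxi ixi r hnu.
move=> /=; set s := \big[_/_]_(_ < _) (r _)%:E; apply: (@le_trans _ _ 1%E); last first.
  elim/big_rec : _ => // m x _ x1; rewrite -[leLHS]mule1.
  by apply: lee_pmul => //; exact: Gnorm_self_ge1.
apply: esup0_le => // _ [X [b b1 QX] <-].
apply: esup0_le => // _ [p [p2 ps] <-].
have p1 : 1 <= p by lra.
(* Since [p < s <= r m], the point [p] lies where class G makes the m-th supremum positive and
   finite. *)
have nup m : (0 < sup_norm xi n m p < +oo)%E.
  have [_ _ nu0 _ _] := hnu m; apply: nu0; rewrite p1 -lte_fin/=.
  exact: lt_le_trans ps (bigmin_le _ _ _).
have [zeta0 Xzeta] := rv_norm_le_zeta p1 cxi ixi nup b1 QX.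
exact: dive_le1.
Qed.
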